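(* For all $k,t\in \mathbb{N}$, there exists $k'\in \mathbb{N}$ such that the following holds: if $G$ is a $K_{t,t}$-free graph such that every induced subgraph of $G$ admits $(k,1)$-balanced separators, then $G$ has a $(k',2)$-centred tree-decomposition.
   Context: All graphs are finite and simple. A graph $G$ is $H$-free if it has no induced subgraph isomorphic to $H$. Distances $\operatorname{dist}_G$ are measured in the graph $G$; for $\hat S\subseteq V(G)$ and $r\in\mathbb{N}$, $N^r_G[\hat S]$ is the set of vertices of $G$ at distance at most $r$ from $\hat S$ in $G$. A set $S\subseteq V(G)$ is $(k,r)$-centred if $S\subseteq N_G^r[\hat S]$ for some $\hat S\subseteq V(G)$ with $|\hat S|\le k$ (distances taken in $G$, not in $G[S]$). A tree-decomposition $(T,\beta)$ of $G$ consists of a tree $T$ and bags $\beta(x)\subseteq V(G)$, $x\in V(T)$, such that every edge of $G$ has both ends in some bag and for each vertex $v$ the set of nodes whose bags contain $v$ induces a nonempty connected subtree of $T$; it is $(k,r)$-centred if every bag is $(k,r)$-centred. For a vertex-weight function $\mu\colon V(G)\to\mathbb{R}_{\ge0}$, a set $S\subseteq V(G)$ is a balanced separator for $\mu$ if every connected component $C$ of $G-S$ has $\sum_{v\in V(C)}\mu(v)\le \frac12\sum_{v\in V(G)}\mu(v)$. A graph $G$ admits $(k,r)$-balanced separators if for every $\mu\colon V(G)\to\mathbb{R}_{\ge0}$ there is a $(k,r)$-centred set (in $G$) which is a balanced separator for $\mu$. *)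

(* Defs.v *)
From HB Require Import structures.
From mathcomp Require Import all_boot all_order all_algebra.
From mathcomp Require Import reals.

Set Implicit Arguments.
Unset Strict Implicit.
Unset Printing Implicit Defensive.

Import Order.TTheory GRing.Theory Num.Theory.

Record sgraph := SGraph {
  vert :> finType;
  adj : rel vert;
  adj_sym : symmetric adj;
  adj_irrefl : irreflexive adj
}.

Section Induced.
Variables (G : sgraph) (A : {set G}).

Definition induced_adj : rel {x : G | x \in A} :=
  fun x y => adj (val x) (val y).

Lemma induced_adj_sym : symmetric induced_adj.
Proof. by move=> x y; exact: adj_sym. Qed.

Lemma induced_adj_irrefl : irreflexive induced_adj.
Proof. by move=> x; exact: adj_irrefl. Qed.

Definition induced : sgraph := SGraph induced_adj_sym induced_adj_irrefl.
End Induced.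

Definition isomorphic (G H : sgraph) : Prop :=
  exists f : G -> H, bijective f /\ forall x y, adj (f x) (f y) = adj x y.

Definition induced_free (H G : sgraph) : Prop :=
  forall A : {set G}, ~ isomorphic (induced A) H.

Section CompleteBipartite.
Variables s t : nat.

Definition biclique_adj : rel ('I_s + 'I_t)%type :=
  fun x y => match x, y with
             | inl _, inr _ | inr _, inl _ => true
             | _, _ => false
             end.

Lemma biclique_adj_sym : symmetric biclique_adj.
Proof. by case=> ? [] ?. Qed.

Lemma biclique_adj_irrefl : irreflexive biclique_adj.
Proof. by case=> ?. Qed.

Definition biclique : sgraph := SGraph biclique_adj_sym biclique_adj_irrefl.
End CompleteBipartite.

Section Distance.
Variable G : sgraph.
Implicit Types (x y : G) (S : {set G}).

Definition has_walk n x y : bool :=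
  [exists p : n.-tuple G, path (@adj G) x p && (last x p == y)].

(* The distance is infinite (no [d] qualifies) between distinct components. *)
Definition is_dist d x y : bool :=
  has_walk d x y && [forall n : 'I_d, ~~ has_walk n x y].

Definition dist_le r x y : bool := [exists d : 'I_r.+1, is_dist d x y].

Definition nbhd r S : {set G} := [set v | [exists u in S, dist_le r u v]].

Definition centred (k r : nat) (S : {set G}) : Prop :=
  exists S' : {set G}, #|S'| <= k /\ S \subset nbhd r S'.
End Distance.

Definition connected_graph (G : sgraph) : Prop :=
  0 < #|G| /\ forall x y : G, connect (@adj G) x y.

Definition acyclic_graph (G : sgraph) : Prop :=
  forall c : seq G, ucycle (@adj G) c -> size c <= 2.

Definition is_tree (T : sgraph) : Prop := connected_graph T /\ acyclic_graph T.

Record tree_decomposition (G T : sgraph) (beta : T -> {set G}) : Prop := {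
  td_tree : is_tree T;
  td_edge : forall u v : G, adj u v ->
    exists x : T, u \in beta x /\ v \in beta x;
  td_vertex : forall v : G, connected_graph (induced [set x : T | v \in beta x])
}.

Definition has_centred_tree_decomposition (k r : nat) (G : sgraph) : Prop :=
  exists (T : sgraph) (beta : T -> {set G}),
    tree_decomposition beta /\ forall x : T, centred k r (beta x).

Definition components (G : sgraph) : {set {set G}} :=
  equivalence_partition (connect (@adj G)) [set: G].

Local Open Scope ring_scope.

Definition balanced_separator (R : realType) (G : sgraph) (mu : G -> R)
    (S : {set G}) : Prop :=
  forall C : {set induced (~: S)}, C \in components (induced (~: S)) ->
    \sum_(v in C) mu (val v) <= 2^-1 * \sum_(v : G) mu v.

Definition admits_balanced_separators (R : realType) (k r : nat)
    (G : sgraph) : Prop :=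
  forall mu : G -> R, (forall v, 0 <= mu v) ->
    exists S : {set G}, centred k r S /\ balanced_separator mu S.

(* Main.v *)
Require Import Defs.
From mathcomp Require Import all_boot all_order all_algebra.
From mathcomp Require Import reals.
From mathcomp Require Import zify.

(** Every bag boundary [N(C)] is kept inside [N[S]] for a set [S] of bounded
    independence number, though of unbounded size; then [S] is dominated by
    boundedly many vertices, which is where the radius 2 comes from.  To split
    [C], let [V] be the set of the vertices whose neighbourhood contains a large
    independent subset of [S], and separate a maximum independent subset [I] of
    [S] in [G - V].  The separator meets [S] in a set of small independence
    number because its centres avoid [V], and an exchange argument with [I]
    bounds the independence number of [S] in each component.

    It remains to bound the independence number of [V].  If [v_1, ..., v_f] in
    [V] are independent and [I_1, ..., I_f] are large independent subsets of
    their neighbourhoods in [S] ("rows"), then the exclusion of an induced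
    biclique makes the adjacencies between distinct rows sparse, so a separator
    that is balanced for the [v_i] destroys only few rows and splits the others
    into anticomplete groups.  Iterating this yields an independent subset of
    [S] of size larger than the independence number of [S]. *)

Set Implicit Arguments.
Unset Strict Implicit.
Unset Printing Implicit Defensive.

(** * Independence, domination, and connectivity inside a vertex set *)

Section Basics.
Variable G : sgraph.
Implicit Types (x y v w : G) (A B I J S : {set G}).

Definition nb x : {set G} := [set y | adj x y].

Definition cl_nb S : {set G} := S :|: \bigcup_(x in S) nb x.

Definition indep I : bool := [forall x in I, forall y in I, ~~ adj x y].

Definition alpha_le n S : Prop :=
  forall I, I \subset S -> indep I -> #|I| <= n.

(** Connectivity in the subgraph induced on [B], stated on the vertices of [G] so that different
    sets [B] can be compared without changing types. It is reflexive even at vertices outside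
    [B]. *)
Definition conn B : rel G :=
  connect (fun x y => [&& x \in B, y \in B & adj x y]).

Lemma indepP I : reflect {in I &, forall x y, ~~ adj x y} (indep I).
Proof.
apply: (iffP forall_inP) => [h x y xI yI | h x xI].
  by move/forall_inP: (h x xI); apply.
by apply/forall_inP => y yI; apply: h.
Qed.

Lemma indepS A B : A \subset B -> indep B -> indep A.
Proof.
move=> /subsetP sAB /indepP iB; apply/indepP => x y xA yA.
by apply: iB; apply: sAB.
Qed.

Lemma indepU A B : indep A -> indep B ->
  (forall x y, x \in A -> y \in B -> ~~ adj x y) -> indep (A :|: B).
Proof.
move=> /indepP iA /indepP iB AB; apply/indepP => x y.
case/setUP => hx /setUP [] hy; [exact: iA|exact: AB| |exact: iB].
by rewrite adj_sym; apply: AB.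
Qed.

Lemma in_nb x y : (y \in nb x) = adj x y.
Proof. by rewrite inE. Qed.

Lemma cl_nbP S y :
  reflect (y \in S \/ exists2 x, x \in S & adj x y) (y \in cl_nb S).
Proof.
apply: (iffP setUP) => -[yS|]; [by left| |by left|].
  by case/bigcupP => x xS; rewrite in_nb; right; exists x.
by case=> x xS xy; right; apply/bigcupP; exists x; rewrite ?in_nb.
Qed.

Lemma sub_cl_nb S : S \subset cl_nb S.
Proof. exact: subsetUl. Qed.

Lemma cl_nbS A B : A \subset B -> cl_nb A \subset cl_nb B.
Proof.
move=> /subsetP sAB; apply/subsetP => y /cl_nbP[yA|[x xA xy]]; apply/cl_nbP.
  by left; apply: sAB.
by right; exists x => //; apply: sAB.
Qed.

Lemma max_indep S :
  exists I, [/\ I \subset S, indep I &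
    forall J, J \subset S -> indep J -> #|J| <= #|I|].
Proof.
pose p := [pred I : {set G} | (I \subset S) && indep I].
have p0 : p set0.
  by rewrite /= sub0set; apply/indepP => x y; rewrite inE.
case: (@arg_maxnP _ set0 p (fun I : {set G} => #|I|) p0) => I /andP[IS iI] h.
by exists I; split=> // J JS iJ; apply: h; rewrite /= JS iJ.
Qed.

(** A maximum independent subset of [S] is maximal, hence dominates [S]. *)
Lemma dominating_subset n S : alpha_le n S ->
  exists I, #|I| <= n /\ S \subset cl_nb I.
Proof.
move=> aS; have [I [IS iI Imax]] := max_indep S.
exists I; split; first exact: aS.
apply/subsetP => x xS; apply/cl_nbP; case: (boolP (x \in I)) => [|xI].
  by left.
case: (boolP [exists y in I, adj y x]) => [/exists_inP[y]|].
  by right; exists y.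
rewrite negb_exists_in => /forall_inP nx.
have iX : indep (x |: I).
  apply: indepU => //.
    by apply/indepP => a b /set1P-> /set1P->; rewrite adj_irrefl.
  by move=> a b /set1P-> bI; rewrite adj_sym nx.
have xIS : x |: I \subset S by rewrite subUset sub1set xS.
by have := Imax _ xIS iX; rewrite cardsU1 xI add1n ltnn.
Qed.

Lemma conn_sym B : connect_sym (fun x y => [&& x \in B, y \in B & adj x y]).
Proof.
by apply: sym_connect_sym => x y; rewrite adj_sym andbCA.
Qed.

Lemma conn_in B x y : x \in B -> conn B x y -> y \in B.
Proof.
move=> xB /connectP[p pP ->] {y}; elim: p x xB pP => //= y p IH x xB.
by case/andP => /and3P[_ yB _]; apply: IH.
Qed.

Lemma conn_adj B x y z : y \in B -> z \in B -> conn B x y -> adj y z ->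
  conn B x z.
Proof.
move=> yB zB xy yz; apply: connect_trans xy (connect1 _).
by rewrite yB zB.
Qed.

Lemma connS A B x y : A \subset B -> conn A x y -> conn B x y.
Proof.
move=> /subsetP sAB; apply: connect_sub => a b /and3P[aA bA ab].
by apply: connect1; rewrite !sAB.
Qed.

Lemma dist_le_walk r d x y : d <= r -> has_walk d x y -> dist_le r x y.
Proof.
move=> dr hw; have ex : exists d, has_walk d x y by exists d.
case: (ex_minnP ex) => e he emin.
have er : e < r.+1 by rewrite ltnS (leq_trans (emin _ hw)).
apply/existsP; exists (Ordinal er); rewrite /is_dist /= he /=.
apply/forallP => i; apply/negP => hi.
by have := leq_trans (ltn_ord i) (emin _ hi); rewrite ltnn.
Qed.

Lemma dist_le1 x y : dist_le 1 x y -> x = y \/ adj x y.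
Proof.
case/existsP => -[[|[|//]] /= _] /andP[/existsP[p /andP[pP /eqP <-]] _].
  by rewrite (tuple0 p); left.
by case/tupleP: p pP => z p; rewrite (tuple0 p) /= andbT; right.
Qed.

Lemma nbhd1_sub S : nbhd 1 S \subset cl_nb S.
Proof.
apply/subsetP => y; rewrite inE => /exists_inP[x xS /dist_le1[<-|xy]].
  exact: (subsetP (sub_cl_nb S)).
by apply/cl_nbP; right; exists x.
Qed.

Lemma cl_nb2_sub S : cl_nb (cl_nb S) \subset nbhd 2 S.
Proof.
apply/subsetP => z h; rewrite inE; apply/exists_inP.
case/cl_nbP: h => [/cl_nbP[zS|[x xS xz]]|[y /cl_nbP[yS|[x xS xy]] yz]].
- exists z => //; apply: (@dist_le_walk 2 0) => //.
  by apply/existsP; exists [tuple] => /=.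
- exists x => //; apply: (@dist_le_walk 2 1) => //.
  by apply/existsP; exists [tuple z]; rewrite /= xz eqxx.
- exists y => //; apply: (@dist_le_walk 2 1) => //.
  by apply/existsP; exists [tuple z]; rewrite /= yz eqxx.
- exists x => //; apply: (@dist_le_walk 2 2) => //.
  by apply/existsP; exists [tuple y; z]; rewrite /= xy yz eqxx.
Qed.

(** Pulls paths back to the subtype. A general [U] serves both the whole induced subgraph and what
    is left of it after a separator is removed. *)
Lemma conn_lift A (U : {set induced A}) (x y : induced A) :
  x \in U -> conn (val @: U) (val x) (val y) ->
  connect (fun a b : induced A => [&& a \in U, b \in U & adj a b]) x y.
Proof.
move=> xU /connectP[p]; elim: p x xU => [|z p IH] x xU /=.
  by move=> _ /val_inj ->.
case/andP => /and3P[_ /imsetP[z' z'U ->] xz] pP yl.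
by apply: connect_trans (connect1 _) (IH z' z'U pP yl); rewrite xU z'U.
Qed.

Lemma conn_induced B (x y : induced B) :
  conn B (val x) (val y) -> connect (@adj (induced B)) x y.
Proof.
have eB : B = val @: [set: induced B].
  apply/setP => a; apply/idP/imsetP => [aB|[[b bB] _ ->]] //.
  by exists (Sub a aB : induced B); rewrite ?inE.
rewrite {1}eB => /(conn_lift (in_setT x)); apply: connect_sub => a b.
by case/and3P => _ _ ab; apply: connect1.
Qed.

End Basics.

Lemma connT (G : sgraph) (x y : G) : conn [set: G] x y = connect (@adj G) x y.
Proof. by apply: eq_connect => a b; rewrite !inE. Qed.

(** * Attaching a leaf to a tree *)

Section AddLeaf.
Variables (T : sgraph) (x0 : T).

Definition leaf_adj : rel (option T) := fun x y =>
  match x, y with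
  | Some a, Some b => adj a b
  | None, Some a | Some a, None => a == x0
  | None, None => false
  end.

Lemma leaf_adj_sym : symmetric leaf_adj.
Proof. by case=> [a|] [b|] //=; apply: adj_sym. Qed.

Lemma leaf_adj_irrefl : irreflexive leaf_adj.
Proof. by case=> [a|] //=; apply: adj_irrefl. Qed.

Definition add_leaf : sgraph := SGraph leaf_adj_sym leaf_adj_irrefl.

Lemma conn_Some (B : {set T}) (B' : {set add_leaf}) (x y : T) :
  (forall z, z \in B -> Some z \in B') ->
  conn B x y -> conn B' (Some x : add_leaf) (Some y : add_leaf).
Proof.
move=> BB' /connectP[p]; elim: p x => [|z p IH] x /=.
  by move=> _ ->; apply: connect0.
case/andP => /and3P[xB zB xz] pP yl.
apply: connect_trans (connect1 _) (IH z pP yl).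
by rewrite !BB'.
Qed.

(** A cycle of length at least three through the leaf [None] would need two distinct neighbours of
    it, but [x0] is the only one; a cycle avoiding [None] is a cycle of [T]. *)
Lemma add_leaf_tree : is_tree T -> is_tree add_leaf.
Proof.
case=> [[T0 Tc] Ta]; split; first split.
- by rewrite card_option.
- have toN (x : T) : connect (@adj add_leaf) (Some x) None.
    have: conn [set: add_leaf] (Some x : add_leaf) (Some x0 : add_leaf).
      by apply: (@conn_Some setT) => [z|]; rewrite ?inE // connT.
    rewrite connT => h; apply: connect_trans h (connect1 _) => /=.
    exact: eqxx.
  have sym := sym_connect_sym (@adj_sym add_leaf).
  case=> [x|] [y|]; rewrite ?connect0 //; last by rewrite sym.
  by apply: connect_trans (toN x) _; rewrite sym.
- move=> c uc; case: (boolP (None \in c)) => [cN|cN].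
    case: (rot_to cN) => i c' ec.
    have := uc; rewrite -(rot_ucycle i) ec -(size_rot i) ec /ucycle.
    case: c' {ec} => [|a [|b c']] // /andP[/=].
    rewrite rcons_path => /and3P[ea _ /andP[_ eb]] /and4P[_ aN _ _].
    have: last b c' \in b :: c' by apply: mem_last.
    move: ea eb aN => {uc cN}; case: a => // a /= /eqP ->.
    by case: (last b c') => // b' /= /eqP -> /negP.
  have ec : c = map Some (pmap id c).
    elim: c cN {uc} => //= -[a|] c IH; rewrite inE ?eqxx // negb_or => /andP[_].
    by move=> /IH {1}->.
  case/andP: uc; rewrite ec => c1 u1; rewrite size_map; apply: Ta.
  have Si : injective (@Some T) by move=> a b [].
  rewrite /ucycle -(map_inj_uniq Si) u1 andbT.
  move: c1; case: (pmap id c) => [|a p] //=.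
  by rewrite -(map_rcons Some) path_map.
Qed.

End AddLeaf.

Lemma is_tree_unit : exists T : sgraph, is_tree T /\ #|T| = 1.
Proof.
have s : symmetric (fun _ _ : unit => false) by [].
have i : irreflexive (fun _ _ : unit => false) by [].
exists (SGraph s i); split; last exact: card_unit.
split; first by split=> [|[] []]; rewrite ?card_unit ?connect0.
by move=> c /andP[_ /card_uniqP <-]; rewrite (leq_trans (max_card _)) ?card_unit.
Qed.

(** * Building a tree-decomposition bag by bag *)

Section Build.
Variable G : sgraph.
Implicit Types (P X W : {set G}) (u v w : G).

Definition component P v : {set G} := [set u | conn (~: P) v u].

Definition bdry P v : {set G} :=
  [set w in P | [exists d in component P v, adj d w]].

Lemma bdryP P v w :
  reflect (w \in P /\ exists2 d, conn (~: P) v d & adj d w) (w \in bdry P v).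
Proof.
rewrite inE; apply: (iffP andP) => -[wP].
  by case/exists_inP => d; rewrite inE; split=> //; exists d.
by case=> d vd dw; split=> //; apply/exists_inP; exists d; rewrite ?inE.
Qed.

(** [Q] is the invariant kept for the boundaries of the components not yet decomposed, [K] the
    requirement on bags. *)
Variables Q K : {set G} -> Prop.

(* [P] collects the vertices in the bags built so far. *)
Record partial_td P (T : sgraph) (beta : T -> {set G}) : Prop := {
  ptd_tree : is_tree T;
  ptd_edge : {in P &, forall u v, adj u v ->
    exists x, u \in beta x /\ v \in beta x};
  ptd_cover : {in P, forall v, exists x, v \in beta x};
  ptd_conn : forall v x y, v \in beta x -> v \in beta y ->
    conn [set z | v \in beta z] x y;
  ptd_sub : forall x, beta x \subset P;
  ptd_bag : forall x, K (beta x);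
  ptd_pending : forall v, v \notin P ->
    exists2 x, bdry P v \subset beta x & Q (bdry P v)
}.

Hypothesis QS : forall W W', W' \subset W -> Q W -> Q W'.
Hypothesis Q0 : Q set0.
Hypothesis K0 : K set0.
(** The next bag for the component of [v] is its boundary together with the part of [X] in it;
    [v \in X] guarantees progress. *)
Hypothesis step : forall P v, v \notin P -> Q (bdry P v) -> exists X,
  [/\ v \in X, K (bdry P v :|: component P v :&: X) &
   forall u, u \in component P v :\: X -> Q (bdry (P :|: component P v :&: X) u)].

(** The new bag is hung on a node [x0] whose bag contains the boundary, so an old vertex in the new
    bag is also in [beta x0] and its nodes stay connected. A remaining component either lies inside
    the component of [v] and is bounded by the new bag, or lies outside and its boundary does not
    grow. *)
Lemma partial_td_step P v (T : sgraph) (beta : T -> {set G}) :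
  partial_td P beta -> v \notin P ->
  exists X (T' : sgraph) (beta' : T' -> {set G}),
    v \in X /\ partial_td (P :|: component P v :&: X) beta'.
Proof.
move=> td vP; have [x0 bx0 Qv] := ptd_pending td vP.
have [X [vX KX QX]] := step vP Qv.
pose b := bdry P v :|: component P v :&: X.
pose P' := P :|: component P v :&: X.
pose beta' (z : add_leaf x0) := if z is Some x then beta x else b.
have compP u w : u \notin P -> conn (~: P) u w -> w \notin P.
  by move=> uP /conn_in; rewrite !inE; apply.
have bP : b \subset P'.
  by apply: setSU; apply/subsetP => w /bdryP[].
have PP' : ~: P' \subset ~: P by rewrite setCS subsetUl.
have cvv : conn (~: P) v v by apply: connect0.
(* An edge at a newly added vertex has both ends in the new bag. *)
have newedge u w : u \in P' -> w \in component P v :&: X -> adj u w -> u \in b.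
  case/setUP => [uP wC uw|uX _ _]; last by rewrite inE uX orbT.
  rewrite inE; apply/orP; left; apply/bdryP; split=> //.
  by exists w; [case/setIP: wC; rewrite inE | rewrite adj_sym].
exists X, (add_leaf x0), beta'; split=> //; split.
- exact/add_leaf_tree/(ptd_tree td).
- move=> u w uP' wP' uw.
  case/setUP: (uP') => [uP|uC]; last first.
    exists None; split; last by apply: newedge uC _; rewrite // adj_sym.
    by rewrite /= inE uC orbT.
  case/setUP: (wP') => [wP|wC]; last first.
    by exists None; split; [apply: newedge uw | rewrite /= inE wC orbT].
  by have [x hx] := ptd_edge td uP wP uw; exists (Some x).
- move=> u /setUP[uP|uC]; last by exists None; rewrite /= inE uC orbT.
  by have [x hx] := ptd_cover td uP; exists (Some x).
- move=> u.
  have SS x y : u \in beta x -> u \in beta y ->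
      conn [set z | u \in beta' z] (Some x : add_leaf x0) (Some y).
    move=> ux uy; apply: (conn_Some _ (ptd_conn td ux uy)) => z.
    by rewrite !inE.
  have SN x : u \in beta x -> u \in b ->
      conn [set z | u \in beta' z] (Some x : add_leaf x0) None.
    move=> ux /setUP[ub|]; last first.
      case/setIP; rewrite inE => /(compP _ _ vP) /negP[].
      exact: (subsetP (ptd_sub td x)).
    have u0 : u \in beta x0 by apply: (subsetP bx0).
    apply: conn_adj (SS x x0 ux u0) _; [by rewrite inE| |exact: eqxx].
    by rewrite inE; apply/setUP; left.
  case=> [x|] [y|] ux uy; [exact: SS|exact: SN| |exact: connect0].
  by rewrite /conn conn_sym; apply: SN.
- case=> [x|] //=; apply: subset_trans (ptd_sub td x) _; exact: subsetUl.
- by case=> [x|] /=; [apply: (ptd_bag td)|].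
- move=> u uP'.
  have uP : u \notin P by apply: contra uP' => uP; rewrite inE uP.
  case: (boolP (u \in component P v)) => uC.
    exists None; last first.
      apply: QX; apply/setDP; split=> //; apply: contra uP' => uX.
      by apply/setUP; right; apply/setIP.
    apply/subsetP => w /bdryP[/setUP[wP|wC] [d ud dw]]; rewrite /= inE.
      apply/orP; left; apply/bdryP; split=> //; exists d => //.
      move: uC; rewrite inE => /connect_trans; apply.
      exact: connS ud.
    by rewrite wC orbT.
  have [x bx Qu] := ptd_pending td uP.
  have sb : bdry P' u \subset bdry P u.
    apply/subsetP => w /bdryP[/setUP[wP|/setIP[wC _]] [d ud dw]].
      by apply/bdryP; split=> //; exists d => //; apply: connS ud.
    (* A new vertex on the boundary for [u] would connect [u] to [v] outside [P]. *)
    case/negP: uC; rewrite inE; move: wC; rewrite inE => vw.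
    have ud' := connS PP' ud.
    rewrite /conn conn_sym; apply: (connect_trans ud').
    rewrite conn_sym; apply: (@conn_adj _ _ _ w) => //.
    - by rewrite inE; apply: compP vw.
    - by rewrite inE; apply: compP ud'.
    - by rewrite adj_sym.
  by exists (Some x) => //=; [apply: subset_trans bx | apply: QS Qu].
Qed.

(** Start from a single node with an empty bag, where all boundaries are empty, and repeat
    [partial_td_step]; the number of vertices outside [P] drops each time. *)
Lemma tree_decomposition_exists :
  exists (T : sgraph) (beta : T -> {set G}),
    tree_decomposition beta /\ forall x, K (beta x).
Proof.
have H P (T : sgraph) (beta : T -> {set G}) : partial_td P beta ->
    exists (T' : sgraph) (beta' : T' -> {set G}), partial_td setT beta'.
  have [m] := ubnP #|~: P|; elim: m => // m IH in P T beta * => Pm td.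
  case: (set_0Vmem (~: P)) => [P0|[v]]; last first.
    rewrite inE => vP; have [X [T' [beta' [vX td']]]] := partial_td_step td vP.
    apply: IH td'; move: Pm; rewrite ltnS; apply: leq_trans; apply: proper_card.
    apply/properP; split; first by rewrite setCS subsetUl.
    exists v; rewrite !inE ?vP // vX; apply/negP; rewrite negb_or => /andP[_].
    by rewrite andbT /conn connect0.
  by exists T, beta; rewrite -[setT]setC0 -P0 setCK.
have [T1 [trT1 cT1]] := is_tree_unit.
have td0 : @partial_td set0 T1 (fun=> set0).
  split=> //; try by move=> ?; rewrite inE.
  move=> v _; have [x _] : exists x : T1, true.
    by have /card_gt0P[x _] : 0 < #|T1|; [rewrite cT1|exists x].
  have -> : bdry set0 v = set0.
    by apply/setP => w; rewrite !inE.
  by exists x.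
have [T [beta td]] := H _ _ _ td0.
exists T, beta; split; last exact: (ptd_bag td).
split; first exact: (ptd_tree td).
  by move=> u v uv; apply: (ptd_edge td); rewrite ?inE.
move=> v; have [x vx] := ptd_cover td (in_setT v); split.
  by apply/card_gt0P; have xB : x \in [set x | v \in beta x]; [rewrite inE|exists (Sub x xB)].
move=> [a av] [b bv]; apply: conn_induced => /=.
by apply: (ptd_conn td); [move: av|move: bv]; rewrite inE.
Qed.

End Build.

(** * Counting tools *)

Lemma subset_of_card (T : finType) (A : {set T}) n :
  n <= #|A| -> exists2 B : {set T}, B \subset A & #|B| = n.
Proof.
move=> /card_geqP[s [us sz sA]]; exists [set x in s].
  by apply/subsetP => x; rewrite inE; apply: sA.
by rewrite cardsE (card_uniqP us).
Qed.

Lemma leq_card_bigcup (I T : finType) (P : {set I}) (F : I -> {set T}) c :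
  (forall i, i \in P -> #|F i| <= c) -> #|\bigcup_(i in P) F i| <= #|P| * c.
Proof.
move=> h; apply: (@leq_trans (\sum_(i in P) #|F i|)).
  elim/big_rec2: _ => [|i n A _ IH]; first by rewrite cards0.
  by rewrite (leq_trans (leq_card_setU _ _)) // leq_add2l.
by rewrite -sum_nat_const; apply: leq_sum.
Qed.

(* Some element has few out-neighbours; delete it together with all its
   in- and out-neighbours and iterate. *)
Lemma select_unrelated (T : finType) (r : rel T) b f (F : {set T}) :
  (forall v, v \in F -> #|[set w in F | r w v]| <= b) ->
  (2 * b + 1) * f <= #|F| ->
  exists2 F' : {set T}, F' \subset F & #|F'| = f /\
    {in F' &, forall v w, v != w -> ~~ r v w}.
Proof.
elim: f F => [|f IH] F hin hF.
  exists set0; first exact: sub0set.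
  by rewrite cards0; split=> // v w; rewrite inE.
(* In-degrees and out-degrees have the same sum, so not all out-degrees exceed [b]. *)
have [w wF wout] : exists2 w, w \in F & #|[set v in F | r w v]| <= b.
  case: (boolP [exists w in F, #|[set v in F | r w v]| <= b]).
    by case/exists_inP => w; exists w.
  rewrite negb_exists_in => /forall_inP h; exfalso.
  have e : \sum_(w in F) #|[set v in F | r w v]| =
           \sum_(v in F) #|[set w in F | r w v]|.
    under eq_bigr do rewrite -sum1dep_card big_mkcondr.
    under [RHS]eq_bigr do rewrite -sum1dep_card big_mkcondr.
    exact: exchange_big.
  have up : \sum_(v in F) #|[set w in F | r w v]| <= #|F| * b.
    by rewrite -sum_nat_const; apply: leq_sum.
  have lo : #|F| * b.+1 <= \sum_(w in F) #|[set v in F | r w v]|.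
    by rewrite -sum_nat_const; apply: leq_sum => w /h; rewrite -ltnNge.
  by nia.
pose D := w |: ([set v in F | r w v] :|: [set v in F | r v w]).
have cD : #|D| <= 2 * b + 1.
  have h1 := hin w wF.
  have h2 := (leq_card_setU [set v in F | r w v] [set v in F | r v w]).1.
  have := (leq_card_setU [set w]
    ([set v in F | r w v] :|: [set v in F | r v w])).1.
  by rewrite cards1 -/D; lia.
have [||F' sF' [cF' uF']] := IH (F :\: D).
- move=> v /setDP[vF _]; apply: leq_trans (hin v vF); apply: subset_leq_card.
  by apply/subsetP => u; rewrite !inE => /andP[/andP[_ ->] ->].
- by have := cardsD F D; have := subset_leq_card (subsetIr F D); nia.
have wF' : w \notin F'.
  by apply/negP => /(subsetP sF'); rewrite !inE eqxx.
exists (w |: F').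
  by rewrite subUset sub1set wF (subset_trans sF') // subsetDl.
rewrite cardsU1 wF' cF'; split=> // u v.
case/setU1P => [->|uI] /setU1P[->|vI]; rewrite ?eqxx //; last exact: uF'.
  move: (subsetP sF' _ vI); rewrite !inE !negb_or => /andP[/and3P[_ h _] vF].
  by move: h; rewrite vF.
move: (subsetP sF' _ uI); rewrite !inE !negb_or => /andP[/and3P[_ _ h] vF].
by move: h; rewrite vF.
Qed.

(** * Consequences of excluding an induced biclique *)

Section Biclique.
Variables (G : sgraph) (t : nat).
Implicit Types (I V X Y : {set G}).

(** Complete adjacency makes [X] and [Y] disjoint, so enumerating them embeds the biclique
    injectively into the subgraph induced on their union; cardinality makes this map bijective, and
    its inverse is the isomorphism. *)
Lemma induced_biclique X Y : #|X| = t -> #|Y| = t -> indep X -> indep Y ->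
  (forall x y, x \in X -> y \in Y -> adj x y) ->
  ~ induced_free (biclique t t) G.
Proof.
move=> cX cY iX iY XY free; pose A := X :|: Y.
have XA (i : 'I_t) : enum_val (cast_ord (esym cX) i) \in A.
  by rewrite inE enum_valP.
have YA (i : 'I_t) : enum_val (cast_ord (esym cY) i) \in A.
  by rewrite inE enum_valP orbT.
pose g (z : biclique t t) : induced A :=
  match z with
  | inl i => exist (fun x => x \in A) _ (XA i)
  | inr i => exist (fun x => x \in A) _ (YA i)
  end.
have disj x : x \in X -> x \in Y -> False.
  by move=> xX xY; have := XY x x xX xY; rewrite adj_irrefl.
have gadj a b : adj (g a) (g b) = adj a b.
  case: a b => [i|i] [j|j]; rewrite /= /induced_adj /=.
  - by apply/negbTE/(indepP _ iX); apply: enum_valP.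
  - by apply: XY; apply: enum_valP.
  - by rewrite adj_sym; apply: XY; apply: enum_valP.
  - by apply/negbTE/(indepP _ iY); apply: enum_valP.
have ginj : injective g.
  case=> [i|i] [j|j] /(congr1 val) /=.
  - by move/enum_val_inj/cast_ord_inj ->.
  - by move=> e; case: (disj _ (enum_valP (cast_ord (esym cX) i))); rewrite e enum_valP.
  - by move=> e; case: (disj _ (enum_valP (cast_ord (esym cX) j))); rewrite -e enum_valP.
  - by move/enum_val_inj/cast_ord_inj ->.
have cA : #|induced A| <= #|biclique t t|.
  have -> : #|induced A| = #|A| by rewrite card_sig; apply: eq_card.
  have := (leq_card_setU X Y).1; rewrite -/A cX cY.
  by rewrite card_sum card_ord.
have [f gf fg] := inj_card_bij ginj cA.
apply: (free A); exists f; split; first by exists g.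
by move=> x y; rewrite -gadj !fg.
Qed.

Hypothesis free : induced_free (biclique t t) G.

(* Koevari--Sos--Turan: a fraction [1 / (2 h)] of the vertices of [I] have [t]
   neighbours among any [2 t h] vertices of [V], and [t] of them have the same
   trace there by the pigeonhole principle. *)
Lemma few_heavy h I V : 0 < t -> 0 < h -> indep I -> indep V ->
  (forall v, v \in V -> #|I| <= h * #|nb v :&: I|) ->
  t * (2 * t * h) * 2 ^ (2 * t * h) <= #|I| -> #|V| < 2 * t * h.
Proof.
move=> t0 h0 iI iV hV; set b := 2 * t * h => bI; rewrite ltnNge; apply/negP => bV.
have [V' sV cV] := subset_of_card bV.
have iV' := indepS sV iV.
pose Ip := [set x in I | t <= #|nb x :&: V'|].
have cI : t * 2 ^ b <= #|Ip|.
  (* Count the edges between [I] and [V'] from both sides: at least [2 * t * #|I|] seen from [V'],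
     at most [#|Ip| * b + #|I| * t] seen from [I]. *)
  have e : \sum_(x in I) #|nb x :&: V'| = \sum_(v in V') #|nb v :&: I|.
    have ee (B C : {set G}) : \sum_(x in B) #|nb x :&: C| =
        \sum_(x in B) \sum_(y in C) adj x y.
      apply: eq_bigr => x _; rewrite -sum1_card big_mkcond [RHS]big_mkcond /=.
      by apply: eq_bigr => y _; rewrite !inE; case: (y \in C); case: (adj x y).
    rewrite !ee exchange_big /=; apply: eq_bigr => v _; apply: eq_bigr => x _.
    by rewrite adj_sym.
  have lo : b * #|I| <= h * \sum_(v in V') #|nb v :&: I|.
    rewrite -cV -sum_nat_const big_distrr /=; apply: leq_sum => v vV.
    by apply: hV; apply: (subsetP sV).
  have up : \sum_(x in I) #|nb x :&: V'| <= #|Ip| * b + #|I| * t.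
    have sI : #|Ip| * b = \sum_(x in I) (x \in Ip) * b.
      rewrite -big_distrl /= -sum1_card big_mkcond [in RHS]big_mkcond /=.
      congr (_ * b); apply: eq_bigr => x _; rewrite inE.
      by case: (x \in I) => //=; case: (_ <= _).
    rewrite sI -sum_nat_const -big_split /=; apply: leq_sum => x xI.
    rewrite !inE xI /=; case: (leqP t #|nb x :&: V'|) => [_|/ltnW -> //].
    by rewrite mul1n -cV (leq_trans (subset_leq_card (subsetIr _ _))) // leq_addr.
  by rewrite -e in lo; nia.
have [Y hY] : exists Y : {set G}, t <= #|[set x in Ip | nb x :&: V' == Y]|.
  case: (boolP [exists Y : {set G}, t <= #|[set x in Ip | nb x :&: V' == Y]|]).
    by case/existsP => Y; exists Y.
  rewrite negb_exists => /forallP hs; exfalso.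
  have : #|Ip| <= #|powerset V'| * t.-1.
    have -> : Ip = \bigcup_(Y in powerset V') [set x in Ip | nb x :&: V' == Y].
      apply/setP => x; apply/idP/bigcupP => [xI|[Y _]].
        by exists (nb x :&: V'); rewrite ?powersetE ?subsetIr // inE xI eqxx.
      by rewrite inE => /andP[].
    by apply: leq_card_bigcup => Y _; have := hs Y; lia.
  rewrite card_powerset cV; have := expn_gt0 2 b; nia.
have [X sX cX] := subset_of_card hY.
have /card_gt0P[x0 x0X] : 0 < #|X| by rewrite cX.
have XP x : x \in X -> [/\ x \in I, t <= #|nb x :&: V'| & nb x :&: V' = Y].
  by move/(subsetP sX); rewrite !inE => /andP[/andP[-> ->] /eqP ->].
have [_ tY eY] := XP _ x0X; rewrite eY in tY.
have [Y' sY cY] := subset_of_card tY.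
apply: (@induced_biclique X Y') => //.
- by apply: indepS iI; apply/subsetP => x /XP[].
- by apply: indepS iV'; apply: subset_trans sY _; rewrite -eY subsetIr.
- move=> x y /XP[_ _ e] /(subsetP sY); rewrite -e => /setIP[].
  by rewrite in_nb.
Qed.

End Biclique.

(** * Balanced separators and independent sets built from rows *)

Section Separators.
Variables (G : sgraph) (k : nat).
Implicit Types (A B F I J S V W X Z P : {set G}).

(** The separator property of the subgraph induced on [A] for the indicator weight of [F], without
    real numbers. The centres [Z] stay in [A], while [cl_nb] is taken in [G]. *)
Definition has_separator A F : Prop :=
  exists Z S, [/\ #|Z| <= k, Z \subset A, S \subset cl_nb Z &
    forall v, v \in A :\: S ->
      2 * #|F :&: [set u | conn (A :\: S) v u]| <= #|F|].

Lemma separator_of_weight (R : realType) A F :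
  admits_balanced_separators R k 1 (induced A) -> F \subset A ->
  has_separator A F.
Proof.
move=> adm /subsetP FA.
pose mu (x : induced A) : R := ((val x \in F)%:R)%R.
have [|S' [[Z' [cZ sZ]] bal]] := adm mu.
  by move=> x; rewrite Num.Theory.ler0n.
exists (val @: Z'), (val @: S'); split.
- exact: leq_trans (leq_imset_card _ _) cZ.
- by apply/subsetP => _ /imsetP[[x xA] _ ->].
- apply/subsetP => _ /imsetP[x xS ->]; apply/cl_nbP.
  have /cl_nbP[xZ|[y yZ yx]] := subsetP (nbhd1_sub Z') _ (subsetP sZ _ xS).
    by left; apply: imset_f.
  by right; exists (val y); first exact: imset_f.
have eB : A :\: val @: S' = val @: ~: S'.
  apply/setP => x; apply/setDP/imsetP => [[xA xS]|[y yS ->]].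
    exists (exist _ x xA : induced A) => //; rewrite inE; apply: contra xS => xS.
    by apply/imsetP; exists (exist _ x xA : induced A).
  split; first exact: (valP y).
  by apply/negP => /imsetP[z zS /val_inj e]; rewrite e inE zS in yS.
rewrite eB => _ /imsetP[v vS ->].
pose v1 : induced (~: S') := exist _ v vS.
pose C := [set y in [set: induced (~: S')] | connect (@adj _) v1 y].
have CC : C \in components (induced (~: S')) by apply: imset_f; rewrite inE.
have {bal} := bal C CC.
have muE x : mu x = (if val x \in F then 1 else 0)%R.
  by rewrite /mu; case: (_ \in F).
have -> : (\sum_(v : induced A) mu v = #|F|%:R :> R)%R.
  under eq_bigr do rewrite muE.
  rewrite -big_mkcond /= GRing.Theory.sumr_const; congr (_%:R)%R.
  rewrite -(card_imset _ (@val_inj _ _ (induced A))); apply: eq_card => x.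
  apply/imsetP/idP => [[y yF ->] //|xF].
  by exists (exist _ x (FA x xF) : induced A).
pose D := [set w in C | val (val w) \in F].
have -> : (\sum_(v in C) mu (val v) = #|D|%:R :> R)%R.
  under eq_bigr do rewrite muE.
  rewrite -big_mkcondr /= GRing.Theory.sumr_const; congr (_%:R)%R.
  by apply: eq_card => w; rewrite [RHS]inE.
rewrite Num.Theory.ler_pdivlMl ?Num.Theory.ltr0n // -GRing.natrM Num.Theory.ler_nat.
apply: leq_trans; rewrite leq_mul2l /=.
apply: leq_trans (leq_imset_card (fun w => val (val w)) _).
apply: subset_leq_card; apply/subsetP => u; rewrite inE => /andP[uF].
rewrite inE => vu.
have /imsetP[u1 u1S eu] : u \in val @: ~: S'.
  by apply: conn_in vu; apply: imset_f.
apply/imsetP; exists (exist _ u1 u1S : induced (~: S')) => //.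
rewrite inE -[val (val _)]/(val u1) -eu uF andbT inE in_setT.
apply: conn_induced.
by apply: (conn_lift vS); rewrite -eu.
Qed.

Hypothesis sep : forall A F, F \subset A -> has_separator A F.

(* Number of rows that yield an independent set of [j] row lengths. *)
Fixpoint rows_needed j :=
  if j is j'.+1 then (2 * (rows_needed j' + k)).+1 else 0.

(* A separator that halves the centres [F] leaves one row anticomplete to the
   rows of almost half of the others. *)
Lemma rows_indep s L j F (I : G -> {set G}) :
  indep F -> (forall v, v \in F -> I v \subset nb v) ->
  (forall v, v \in F -> indep (I v)) ->
  (forall v w x, v \in F -> w \in F -> v != w -> x \in I w ->
     ~~ adj v x /\ #|nb x :&: I v| <= s) ->
  (forall v, v \in F -> L + j * (k * s) <= #|I v|) ->
  rows_needed j <= #|F| ->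
  exists J, [/\ J \subset \bigcup_(v in F) I v, indep J & j * L <= #|J|].
Proof.
elim: j F I => [|j IH] F I iF Inb iI sp szI szF.
  exists set0; split; rewrite ?sub0set //.
  by apply/indepP => x y; rewrite inE.
set U := \bigcup_(v in F) I v.
have UP x : x \in U -> exists2 v, v \in F & x \in I v.
  by case/bigcupP => v; exists v.
have IU v x : v \in F -> x \in I v -> x \in U.
  by move=> vF xI; apply/bigcupP; exists v.
have [Z [S0 [cZ ZA SZ half]]] := @sep (F :|: U) F (subsetUl _ _).
pose bad := [set v in F | [exists z in Z, (z == v) || (z \in I v)]].
have cbad : #|bad| <= k.
  (* No [z] can spoil two rows, because [F] is independent and no vertex of a row is adjacent to the
     centre of another; hence at most [k] rows are bad. *)
  pose owner z := odflt z [pick v in F | (z == v) || (z \in I v)].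
  apply: leq_trans cZ; apply: leq_trans (leq_imset_card owner _).
  apply: subset_leq_card; apply/subsetP => v; rewrite inE => /andP[vF].
  case/exists_inP => z zZ zv; apply/imsetP; exists z => //; rewrite /owner.
  case: pickP => [w /andP[wF zw]|/(_ v)]; last by rewrite vF zv.
  apply/eqP; case: (eqVneq v w) => //= vw.
  have nadj a b : a \in F -> b \in F -> ~~ adj a b by apply: (indepP _ iF).
  have inI a b : a \in F -> b \in I a -> adj a b.
    by move=> aF /(subsetP (Inb a aF)); rewrite in_nb.
  case/orP: zv => [/eqP ez|zv]; case/orP: zw => [/eqP ez'|zw].
  - by rewrite -ez ez' eqxx in vw.
  - by have := nadj w v wF vF; rewrite -ez inI.
  - by have := nadj v w vF wF; rewrite -ez' inI.
  - by have [] := sp v w z vF wF vw zw; rewrite inI.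
pose good v := (v \in F) && (v \notin bad).
have goodF v : good v -> v \in F by case/andP.
have goodZ v z : good v -> z \in Z -> z != v /\ z \notin I v.
  case/andP => vF; rewrite inE vF /= negb_exists_in => /forall_inP h /h.
  by rewrite negb_or => /andP[].
pose I' v := I v :\: cl_nb Z.
have szI' v : good v -> L + j * (k * s) <= #|I' v|.
  (* Each [z] in [Z] costs a good row at most [s] vertices: none if [z] is in [F], at most [s] if
     [z] is in another row. *)
  move=> gv; have vF := goodF v gv.
  have : #|I v :&: cl_nb Z| <= k * s.
    apply: (@leq_trans #|\bigcup_(z in Z) (nb z :&: I v)|).
      apply: subset_leq_card; apply/subsetP => x /setIP[xI].
      case/cl_nbP => [xZ|[z zZ zx]].
        by have [_] := goodZ v x gv xZ; rewrite xI.
      by apply/bigcupP; exists z; rewrite // !inE zx.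
    apply: leq_trans (leq_mul cZ (leqnn s)).
    apply: leq_card_bigcup => z zZ; have [zv zI] := goodZ v z gv zZ.
    case/setUP: (subsetP ZA z zZ) => [zF|/UP[w wF zw]].
      rewrite (_ : _ :&: _ = set0) ?cards0 //; apply/setP => x.
      rewrite !inE; apply/negP => /andP[zx xI].
      by have [] := sp z v x zF vF zv xI; rewrite zx.
    have vw : v != w by apply: contra zI => /eqP ->.
    by have [] := sp v w z vF wF vw zw.
  by have := szI v vF; have := cardsD (I v) (cl_nb Z); rewrite -/(I' v); nia.
have Fbad : #|bad| + #|[set v | good v]| = #|F|.
  rewrite -(cardsID bad F); congr addn; apply: eq_card => v; rewrite !inE.
    by case: (v \in F).
  by rewrite /good inE andbC.
have /card_gt0P[v0] : 0 < #|[set v | good v]| by move: szF => /=; lia.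
rewrite inE => g0; have F0 := goodF _ g0.
pose B := (F :|: U) :\: S0.
(* Within [F :|: U] the neighbours of [v] all lie in its own row, which [Z] misses when [v] is
   good. *)
have gB v : good v -> v \in B.
  move=> gv; have vF := goodF _ gv; rewrite !inE vF andbT.
  apply/negP => /(subsetP SZ) /cl_nbP[vZ|[z zZ zv]].
    by have [] := goodZ v v gv vZ; rewrite eqxx.
  have [zv' zI] := goodZ v z gv zZ.
  case/setUP: (subsetP ZA z zZ) => [zF|/UP[w wF zw]].
    by have := indepP _ iF z v zF vF; rewrite zv.
  have vw : v != w by apply: contra zI => /eqP ->.
  by have [] := sp v w z vF wF vw zw; rewrite adj_sym zv.
have IB v x : v \in F -> x \in I' v -> x \in B.
  move=> vF /setDP[xI xZ]; rewrite inE inE (IU v x) // orbT andbT.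
  by apply: contra xZ; apply: (subsetP SZ).
have Iadj v x : v \in F -> x \in I' v -> adj v x.
  by move=> vF /setDP[xI _]; have := subsetP (Inb v vF) x xI; rewrite in_nb.
pose C := [set u | conn B v0 u].
(* At most [k] rows are bad and at most half of [F] is in [C], which gives the recursion of
   [rows_needed]. *)
pose F1 := [set v | good v && (v \notin C)].
have F1g v : v \in F1 -> good v by rewrite inE => /andP[].
have F1F v : v \in F1 -> v \in F by move=> /F1g /goodF.
have cF1 : rows_needed j <= #|F1|.
  have h1 : #|[set v | good v]| <= #|F1| + #|F :&: C|.
    rewrite -(cardsID C) addnC; apply: leq_add; apply: subset_leq_card.
      by apply/subsetP => v /setDP[]; rewrite !inE => -> ->.
    apply/subsetP => v /setIP[]; rewrite inE => /goodF vF vC.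
    by rewrite inE vF.
  have := half v0 (gB _ g0); rewrite -/B -/C; move: szF => /=; lia.
have [||||||J1 [sJ1 iJ1 cJ1]] := IH F1 I'.
- by apply: indepS iF; apply/subsetP => v /F1F.
- by move=> v /F1F vF; apply: subset_trans (Inb v vF); apply: subsetDl.
- by move=> v /F1F vF; apply: indepS (iI v vF); apply: subsetDl.
- move=> v w x /F1F vF /F1F wF vw /setDP[xI _].
  have [h1 h2] := sp v w x vF wF vw xI; split=> //.
  by apply: leq_trans h2; apply: subset_leq_card; apply: setIS; apply: subsetDl.
- by move=> v /F1g /szI'.
- exact: cF1.
have I0C x : x \in I' v0 -> x \in C.
  move=> xI; rewrite inE.
  by apply: (@conn_adj _ _ _ v0 x (gB _ g0) (IB _ _ F0 xI)); rewrite ?Iadj ?/conn ?connect0.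
have J1P x : x \in J1 -> x \in B /\ x \notin C.
  move/(subsetP sJ1) => /bigcupP[v v1 xI]; have vF := F1F v v1.
  have xB := IB _ _ vF xI; split=> //.
  move: v1; rewrite inE => /andP[gv]; apply: contra; rewrite !inE => xC.
  by apply: (conn_adj xB (gB _ gv) xC); rewrite adj_sym Iadj.
exists (I' v0 :|: J1); split.
- rewrite subUset; apply/andP; split; apply/subsetP => x.
    by case/setDP => xI _; apply: IU xI.
  move/(subsetP sJ1) => /bigcupP[v /F1F vF /setDP[xI _]].
  exact: IU xI.
- apply: indepU => // [|x y xI /J1P[yB yC]].
    by apply: indepS (iI _ F0); apply: subsetDl.
  apply: contra yC => xy; have := I0C x xI; rewrite !inE => xC.
  by apply: conn_adj xC xy; rewrite ?(IB _ _ F0 xI).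
- rewrite cardsU (_ : _ :&: J1 = set0) ?cards0 ?subn0.
    by have := szI' v0 g0; nia.
  apply/setP => x; rewrite in_setI in_set0.
  by apply/negP => /andP[/I0C xC /J1P[_ /negP[]]].
Qed.

End Separators.

(** * Rich vertices and the splitting step *)

Section Decompose.
Variables (G : sgraph) (k t : nat).
Implicit Types (A B F I J S V W X Z P : {set G}).

Hypothesis t_gt0 : 0 < t.
Hypothesis free : induced_free (biclique t t) G.
Hypothesis sep : forall A F, F \subset A -> has_separator k A F.

Definition rich N S : {set G} :=
  [set v | [exists I : {set G}, [&& I \subset nb v :&: S, indep I & N <= #|I|]]].

Section FewRich.
Variables m M : nat.
(** [j] blocks of [M] vertices exceed the bound [m * (4 * M)] on the independence number of [S].
    With [q], losing [M %/ q] vertices to each of [f + j * k] foreign vertices costs a row at most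
    [M]. [b] is the bound of [few_heavy] for [h = 4 * q]. *)
Let j := 4 * m + 1.
Let f := rows_needed k j.
Let q := f + j * k + 1.
Let b := 2 * t * (4 * q).

(* After discarding the few vertices which [few_heavy] allows to be adjacent
   to a large part of a foreign row, [f] rows of length [4 M] satisfy the
   hypotheses of [rows_indep] and contain an independent set larger than the
   independence number of [S]. *)
Lemma few_rich S V : alpha_le (m * (4 * M)) S -> indep V ->
  V \subset rich (4 * M) S -> 0 < M ->
  t * b * 2 ^ b <= 4 * M -> f * b <= M -> #|V| < (2 * b + 1) * f.
Proof.
move=> aS iV VR M0 bM fbM; rewrite ltnNge; apply/negP => cV.
have q0 : 0 < 4 * q by rewrite /q; lia.
pose row v := odflt set0
  [pick J : {set G} | [&& J \subset nb v :&: S, indep J & #|J| == 4 * M]].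
have rowP v : v \in V ->
    [/\ row v \subset nb v, row v \subset S, indep (row v) & #|row v| = 4 * M].
  move=> /(subsetP VR); rewrite inE => /existsP[I /and3P[sI iI cI]].
  rewrite /row; case: pickP => [J /and3P[]|].
    by rewrite subsetI => /andP[-> ->] -> /eqP ->.
  have [J sJ cJ] := subset_of_card cI.
  by move/(_ J); rewrite (subset_trans sJ) // (indepS sJ) // cJ eqxx.
(* Used twice: for [W] consisting of centres in [V], and for [W] inside a foreign row. *)
have few W v : v \in V -> indep W ->
    (forall w, w \in W -> 4 * M <= 4 * q * #|nb w :&: row v|) -> #|W| <= b.
  move=> vV iW hW; have [_ _ iI cI] := rowP v vV; apply: ltnW.
  by apply: (few_heavy free t_gt0 q0 iI iW); rewrite cI.
pose r w v := 4 * M <= 4 * q * #|nb w :&: row v|.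
have [v vV|F sF [cF rF]] := @select_unrelated _ r b f V _ cV.
  apply: (few _ v) => // [|w]; last by rewrite inE => /andP[].
  by apply: indepS iV; apply/subsetP => w; rewrite inE => /andP[].
have FV v : v \in F -> v \in V by apply: (subsetP sF).
pose row' v := [set x in row v | [forall w in F, (w != v) ==>
   ~~ adj w x && ~~ r x w]].
pose s := M %/ q.
have sq : s * q <= M by apply: leq_trunc_div.
have rs w v : ~~ r w v -> #|nb w :&: row v| <= s.
  by rewrite /r /s leq_divRL ?addn1 //; lia.
have szrow v : v \in F -> M + j * (k * s) <= #|row' v|.
  move=> vF; have vV := FV v vF; have [_ _ iI cI] := rowP v vV.
  (* [D1] holds the vertices adjacent to a foreign centre, [D2] those heavy to a foreign row. [D1]
     and the reserve [j * (k * s)] together cost at most [M], and so does [D2], so length [4 * M]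
     suffices. *)
  pose D1 := \bigcup_(w in F :\ v) (nb w :&: row v).
  pose D2 := \bigcup_(w in F :\ v) [set x in row v | r x w].
  have cFv : #|F :\ v| <= f by rewrite -cF subset_leq_card // subD1set.
  have c1 : #|D1| <= f * s.
    apply: leq_trans (leq_mul cFv (leqnn s)); apply: leq_card_bigcup => w.
    by case/setD1P => wv wF; apply: rs; apply: rF.
  have c2 : #|D2| <= f * b.
    apply: leq_trans (leq_mul cFv (leqnn b)); apply: leq_card_bigcup => w.
    case/setD1P => _ wF; apply: (few _ w); first exact: FV.
      by apply: indepS iI; apply/subsetP => x; rewrite inE => /andP[].
    by move=> x; rewrite inE => /andP[].
  have sub : row v \subset row' v :|: (D1 :|: D2).
    apply/subsetP => x xI; rewrite inE; case: (boolP (x \in row' v)) => //=.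
    rewrite inE xI /= negb_forall_in => /exists_inP[w wF].
    rewrite negb_imply negb_and !negbK => /andP[wv /orP[wx|xw]]; apply/setUP.
      by left; apply/bigcupP; exists w; rewrite !inE ?wv ?wx.
    by right; apply/bigcupP; exists w; rewrite ?in_setD1 ?wv // inE xI.
  have h1 := subset_leq_card sub.
  have h2 := (leq_card_setU (row' v) (D1 :|: D2)).1.
  have h3 := (leq_card_setU D1 D2).1.
  have h4 : f * s + j * k * s <= M.
    by apply: leq_trans sq; rewrite -mulnDl mulnC leq_mul2l /q; lia.
  by rewrite mulnA; lia.
have [||||||J [sJ iJ cJ]] := @rows_indep G k sep s M j F row'.
- exact: indepS sF iV.
- move=> v /FV vV; have [h _ _ _] := rowP v vV; apply: subset_trans h.
  by apply/subsetP => x; rewrite inE => /andP[].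
- move=> v /FV vV; have [_ _ h _] := rowP v vV; apply: indepS h.
  by apply/subsetP => x; rewrite inE => /andP[].
- move=> v w x vF wF vw; rewrite inE => /andP[xI /forall_inP /(_ v vF)].
  rewrite vw /= => /andP[h1 /rs h2]; split=> //.
  apply: leq_trans h2; apply: subset_leq_card; apply: setIS.
  by apply/subsetP => y; rewrite inE => /andP[].
- exact: szrow.
- by rewrite cF.
have: #|J| <= m * (4 * M).
  apply: aS => //; apply: subset_trans sJ _; apply/bigcupsP => v /FV vV.
  have [_ h _ _] := rowP v vV; apply: subset_trans h.
  by apply/subsetP => x; rewrite inE => /andP[].
by move: cJ; rewrite /j; nia.
Qed.

End FewRich.

(** A centre [z] in [J] dominates only itself there; a centre outside [J] has fewer than [N]
    neighbours in [J], as it is not rich. *)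
Lemma alpha_sep N S Z J : 0 < N -> #|Z| <= k -> Z \subset ~: rich N S ->
  J \subset S -> J \subset cl_nb Z -> indep J -> #|J| <= k * N.
Proof.
move=> N0 cZ ZR JS JZ iJ; apply: leq_trans (leq_mul cZ (leqnn N)).
apply: leq_trans (leq_card_bigcup (F := fun z => J :&: cl_nb [set z]) _).
  apply: subset_leq_card; apply/subsetP => x xJ; apply/bigcupP.
  case/cl_nbP: (subsetP JZ _ xJ) => [xZ|[z zZ zx]].
    by exists x => //; rewrite inE xJ; apply/cl_nbP; left; rewrite inE.
  exists z => //; rewrite inE xJ; apply/cl_nbP; right.
  by exists z; rewrite ?inE.
move=> z zZ.
case: (boolP (z \in J)) => zJ.
  rewrite (leq_trans _ N0) // -(cards1 z); apply: subset_leq_card.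
  apply/subsetP => x /setIP[xJ /cl_nbP[//|[y /set1P -> zx]]].
  by have := indepP _ iJ z x zJ xJ; rewrite zx.
have := subsetP ZR z zZ; rewrite !inE negb_exists => /forallP.
move/(_ (J :&: cl_nb [set z])); rewrite !negb_and => /or3P[] h; last by rewrite ltnW // ltnNge.
  case/negP: h; apply/subsetP => x /setIP[xJ /cl_nbP[/set1P e|]].
    by rewrite -e xJ in zJ.
  by case=> y /set1P -> zx; rewrite !inE zx (subsetP JS).
by case/negP: h; apply: indepS iJ; apply: subsetIl.
Qed.

Section Step.
Variables N a : nat.
Let n := (4 * k + 2) * N.
Hypothesis N_large : 2 * a + k + 1 <= N.
Hypothesis alpha_rich : forall S, alpha_le n S -> alpha_le a (rich N S).

Lemma decomposition_step P v S : v \notin P -> bdry P v \subset cl_nb S ->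
  alpha_le n S -> exists X,
  [/\ v \in X, centred (n + a + k + 1) 2 (bdry P v :|: component P v :&: X) &
   forall u, u \in component P v :\: X ->
     exists S', bdry (P :|: component P v :&: X) u \subset cl_nb S' /\
       alpha_le n S'].
Proof.
move=> vP bS aS; have aR := alpha_rich aS; set V := rich N S in aR.
have N0 : 0 < N by clear -N_large; lia.
have [I [IS iI Imax]] := max_indep S.
have [Z [S0 [cZ ZV SZ half]]] := @sep (~: V) (I :\: V) (subsetDr _ _).
(* [V] joins the bag because the separator was taken in [~: V], where its centres are not rich. *)
pose X := v |: (V :|: S0).
have cvv : conn (~: P) v v by apply: connect0.
have compP w : w \in component P v -> w \notin P.
  by rewrite inE => /conn_in; rewrite !inE; apply.
exists X; split; first by rewrite !inE eqxx.
  have [I1 [c1 s1]] := dominating_subset aS.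
  have [I2 [c2 s2]] := dominating_subset aR.
  (* [I1] reaches the boundary in two steps through [S]; [I2] dominates [V] and [Z] dominates
     [S0]. *)
  pose I3 := v |: (I1 :|: (I2 :|: Z)).
  exists I3; split.
    have h1 := (leq_card_setU [set v] (I1 :|: (I2 :|: Z))).1.
    have h2 := (leq_card_setU I1 (I2 :|: Z)).1.
    have h3 := (leq_card_setU I2 Z).1.
    by move: h1; rewrite cards1 -/I3; clear -c1 c2 cZ h2 h3; lia.
  have h1 : I1 \subset I3 by apply/subsetP => x xI; rewrite !inE xI !orbT.
  have h2 : I2 \subset I3 by apply/subsetP => x xI; rewrite !inE xI !orbT.
  have h3 : Z \subset I3 by apply/subsetP => x xI; rewrite !inE xI !orbT.
  apply: subset_trans (cl_nb2_sub I3); rewrite subUset; apply/andP; split.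
    apply: subset_trans bS _; apply: cl_nbS.
    by apply: subset_trans s1 _; apply: cl_nbS.
  apply: subset_trans (sub_cl_nb _); apply: subset_trans (subsetIr _ _) _.
  rewrite !subUset sub1set; apply/and3P; split.
  - by apply: (subsetP (sub_cl_nb _)); rewrite !inE eqxx.
  - by apply: subset_trans s2 _; apply: cl_nbS.
  - by apply: subset_trans SZ _; apply: cl_nbS.
move=> u /setDP[uC uX]; pose P' := P :|: component P v :&: X.
pose B := ~: V :\: S0.
pose D := [set w | conn B u w].
have XB w : w \notin X -> w \in B.
  by rewrite !inE !negb_or => /and3P[_ -> ->].
have uB := XB u uX.
have DB w : w \in D -> w \in B by rewrite inE; apply: conn_in.
have compD d : conn (~: P') u d -> d \in component P v /\ d \in D.
  move=> ud; have dC : d \in component P v.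
    rewrite inE; move: uC; rewrite inE => /connect_trans; apply.
    by apply: connS ud; rewrite setCS subsetUl.
  split=> //; rewrite inE; move/connectP: ud => [p pP ->] {d dC}.
  elim: p u uC uX {uB D DB} pP => [|y p IH] u uC uX /=.
    by move=> _; apply: connect0.
  case/andP => /and3P[_ yP uy] pP.
  have yC : y \in component P v.
    move: uC; rewrite !inE => vu; apply: (conn_adj _ _ vu uy).
      by rewrite inE compP // inE.
    by move: yP; rewrite !inE negb_or => /andP[].
  have yX : y \notin X.
    apply/negP => yX; move: yP; rewrite in_setC => /negP[].
    by apply/setUP; right; apply/setIP.
  apply: connect_trans (connect1 _) (IH y yC yX pP).
  by rewrite !XB.
(* Boundary vertices in [X] are dominated by [V], [v] or [Z]. Any other one lies in [D], and a
   vertex of [S] dominating it lies in [D], [S0] or [V]. *)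
pose S' := (S :&: D) :|: ((S :&: S0) :|: (V :|: (v |: Z))).
have S'1 : S :&: D \subset S' by apply: subsetUl.
have inS' w : w \in S :&: S0 \/ w \in V \/ w = v \/ w \in Z -> w \in S'.
  move=> h; rewrite in_setU; apply/orP; right; apply/setUP.
  case: h => [->|h]; [by left|right]; apply/setUP.
  case: h => [->|h]; [by left|right]; apply/setU1P.
  exact: h.
have domX w : w \in X -> w \in cl_nb S'.
  case/setU1P => [->|/setUP[wV|wS]]; try by apply/cl_nbP; left; apply: inS'; tauto.
  case/cl_nbP: (subsetP SZ _ wS) => [wZ|[z zZ zw]]; apply/cl_nbP.
    by left; apply: inS'; tauto.
  by right; exists z => //; apply: inS'; tauto.
exists S'; split.
  apply/subsetP => w /bdryP[wP' [d ud dw]].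
  have [dC dD] := compD d ud.
  case: (boolP (w \in X)) => [/domX //|wX].
  have wP : w \in P.
    by case/setUP: wP' => // /setIP[_]; rewrite (negbTE wX).
  have wb : w \in bdry P v.
    by apply/bdryP; split=> //; exists d => //; move: dC; rewrite inE.
  have wD : w \in D.
    rewrite inE; apply: (conn_adj (DB d dD) (XB w wX) _ dw).
    by move: dD; rewrite inE.
  have sS' s0 : s0 \in S -> s0 \in D \/ s0 \notin B -> s0 \in S'.
    move=> sS [sD|sB]; first by apply: (subsetP S'1); rewrite inE sS.
    apply: inS'; move: sB; rewrite in_setD in_setC negb_and !negbK.
    by case/orP => h; [left; apply/setIP | right; left].
  apply/cl_nbP; case/cl_nbP: (subsetP bS _ wb) => [wS|[s0 sS sw]].
    by left; apply: sS'; tauto.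
  right; exists s0 => //; apply: sS' => //.
  case: (boolP (s0 \in B)) => sB; [left|by right].
  rewrite inE; apply: (conn_adj (DB w wD) sB); last by rewrite adj_sym.
  by move: wD; rewrite inE.
move=> J JS iJ.
have asep J' : J' \subset S :&: S0 -> indep J' -> #|J'| <= k * N.
  rewrite subsetI => /andP[JS1 JS2] iJ'.
  by apply: alpha_sep N0 cZ ZV JS1 (subset_trans JS2 SZ) iJ'.
have cJ : #|J| <= #|J :&: (S :&: D)| + #|J :&: (S :&: S0)| + #|J :&: V| + (k + 1).
  have sub : J \subset (J :&: (S :&: D)) :|: ((J :&: (S :&: S0)) :|:
      ((J :&: V) :|: (v |: Z))).
    apply/subsetP => x xJ; have := subsetP JS x xJ; rewrite !inE xJ /=.
    by [].
  apply: leq_trans (subset_leq_card sub) _.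
  rewrite -!addnA; do 3![apply: leq_trans (leq_card_setU _ _) _;
    rewrite leq_add2l].
  by rewrite addnC cardsU1 leq_add // leq_b1.
have cJ0 : #|J :&: (S :&: S0)| <= k * N.
  by apply: asep; [apply: subsetIr | apply: indepS iJ; apply: subsetIl].
have cJV : #|J :&: V| <= a.
  by apply: aR; [apply: subsetIr | apply: indepS iJ; apply: subsetIl].
(* Exchange: [J :&: D] together with the part of [I] outside [D], [S0] and [V]
   is an independent subset of [S], hence no larger than [I]. *)
have cJD : #|J :&: (S :&: D)| <= #|I :&: D| + k * N + a.
  pose I' := I :&: B :\: D.
  have iU : indep (J :&: (S :&: D) :|: I').
    apply: indepU.
    - by apply: indepS iJ; apply: subsetIl.
    - by apply: indepS iI; apply/subsetP => x /setDP[/setIP[]].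
    - move=> x y /setIP[_ /setIP[_ xD]] /setDP[/setIP[_ yB] yD].
      apply: contra yD => xy; rewrite inE; apply: (conn_adj (DB x xD) yB _ xy).
      by move: xD; rewrite inE.
  have sU : J :&: (S :&: D) :|: I' \subset S.
    rewrite subUset; apply/andP; split.
      by apply/subsetP => x /setIP[_ /setIP[]].
    by apply: subset_trans IS; apply/subsetP => x /setDP[/setIP[]].
  have := Imax _ sU iU; rewrite cardsU (_ : _ :&: I' = set0) ?cards0 ?subn0.
    have cI : #|I| <= #|I :&: D| + #|I :&: S0| + #|I :&: V| + #|I'|.
      have sub : I \subset (I :&: D) :|: ((I :&: S0) :|: ((I :&: V) :|: I')).
        apply/subsetP => x xI; rewrite /I' /B !(in_setU, in_setI, in_setD) xI.
        rewrite in_setC /=.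
        by case: (x \in D); case: (x \in S0); case: (x \in V).
      apply: leq_trans (subset_leq_card sub) _.
      rewrite -!addnA; do 2![apply: leq_trans (leq_card_setU _ _) _;
        rewrite leq_add2l].
      exact: (leq_card_setU _ _).1.
    have cI0 : #|I :&: S0| <= k * N.
      apply: asep; last by apply: indepS iI; apply: subsetIl.
      exact: setSI.
    have cIV : #|I :&: V| <= a.
      by apply: aR; [apply: subsetIr | apply: indepS iI; apply: subsetIl].
    by clear -cI cI0 cIV; lia.
  apply/setP => x; rewrite in_setI in_set0; apply/negP.
  by move=> /andP[/setIP[_ /setIP[_ xD]] /setDP[_]]; rewrite xD.
have cID : 2 * #|I :&: D| <= n.
  have h : 2 * #|(I :\: V) :&: D| <= #|I :\: V| := half u uB.
  have -> : I :&: D = (I :\: V) :&: D.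
    apply/setP => x; rewrite !in_setI in_setD.
    case: (boolP (x \in D)) => [/DB|]; rewrite ?andbF // !andbT.
    by rewrite in_setD in_setC => /andP[_ ->].
  apply: leq_trans h _; apply: leq_trans (aS I IS iI).
  exact: subset_leq_card (subsetDl _ _).
(* Half of [n] is [(2 * k + 1) * N], the separator contributes [2 * k * N], and the last [N] absorbs
   [2 * a + k + 1]. *)
rewrite /n in cID *; clear -cJ cJ0 cJV cJD cID N_large; nia.
Qed.

End Step.

End Decompose.

(** * Choice of the constants and assembly *)

Theorem theorem4 (R : realType) (k t : nat) :
  exists k' : nat, forall G : sgraph,
    induced_free (biclique t t) G ->
    (forall A : {set G}, admits_balanced_separators R k 1 (induced A)) ->
    has_centred_tree_decomposition k' 2 G.
Proof.
case: (posnP t) => [->|t0].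
  (* For [t = 0] the biclique is the empty graph, which is induced on [set0] in every graph. *)
  exists 0 => G free _; exfalso.
  apply: (@induced_biclique G 0 set0 set0) free; rewrite ?cards0 //;
    try by apply/indepP => x y; rewrite inE.
  by move=> x y; rewrite inE.
pose m := 4 * k + 2; pose j := 4 * m + 1; pose f := rows_needed k j.
pose b := 2 * t * (4 * (f + j * k + 1)); pose a := (2 * b + 1) * f.
(* [f], [b] and [a] depend only on [k] and [t], so [M] can be chosen after them. With [N = 4 * M],
   the bound [m * (4 * M)] in [few_rich] is the [n] of the splitting step. *)
pose M := t * b * 2 ^ b + f * b + 2 * a + k + 1.
have [M0 M1 M2 M3] : [/\ 0 < M, t * b * 2 ^ b <= 4 * M, f * b <= M &
    2 * a + k + 1 <= 4 * M].
  by rewrite /M; move: (t * b * _) (f * b) (2 * a) => x y z; clear; split; lia.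
pose n := m * (4 * M); exists (n + a + k + 1) => G free adm.
have sep (A F : {set G}) : F \subset A -> has_separator k A F.
  exact: separator_of_weight (adm A).
have aR (S : {set G}) : alpha_le n S -> alpha_le a (@rich G (4 * M) S).
  move=> aS V sV iV; apply: ltnW.
  exact: (few_rich t0 free sep aS iV sV M0 M1 M2).
have [||||T [beta [td cb]]] := @tree_decomposition_exists G
   (fun W => exists S, W \subset cl_nb S /\ alpha_le n S)
   (centred (n + a + k + 1) 2).
- move=> W W' sW [S [WS aS]]; exists S; split=> //.
  exact: subset_trans WS.
- exists set0; split; first exact: sub0set.
  by move=> I; rewrite subset0 => /eqP ->; rewrite cards0.
- by exists set0; rewrite cards0 sub0set.
- move=> P v vP [S [bS aS]]; exact: (decomposition_step sep M3 aR vP bS aS).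
by exists T, beta.
Qed.
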